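(* Let $n\ge 1$. (1) The space $\mathcal R_n$ of left $n$-regular functions $\mathbb H_{\mathbb C}\to\mathbb S\odot\cdots\odot\mathbb S$ (possibly with singularities) is invariant under the action $\pi_{nl}$ of $GL(2,\mathbb H_{\mathbb C})$. (2) The space $\mathcal R'_n$ of right $n$-regular functions $\mathbb H_{\mathbb C}\to\mathbb S'\odot\cdots\odot\mathbb S'$ (possibly with singularities) is invariant under the action $\pi_{nr}$ of $GL(2,\mathbb H_{\mathbb C})$.
   Context: $\mathbb H$ is the algebra of real quaternions with units $e_0=1,e_1,e_2,e_3$ ($e_i^2=e_1e_2e_3=-e_0$ for $1\le i\le 3$, $e_ie_j=-e_je_i$ for $1\le i<j\le3$), and $\mathbb H_{\mathbb C}=\mathbb C\otimes_{\mathbb R}\mathbb H$, with elements $Z=z^0e_0+z^1e_1+z^2e_2+z^3e_3$, $z^i\in\mathbb C$. It is identified with complex $2\times2$ matrices via $e_0=\begin{pmatrix}1&0\\0&1\end{pmatrix}$, $e_1=\begin{pmatrix}0&-i\\-i&0\end{pmatrix}$, $e_2=\begin{pmatrix}0&-1\\1&0\end{pmatrix}$, $e_3=\begin{pmatrix}-i&0\\0&i\end{pmatrix}$. $N(Z)=\sum_i(z^i)^2=\det Z$. $GL(2,\mathbb H_{\mathbb C})\simeq GL(4,\mathbb C)$ is the group of invertible $2\times 2$ matrices with entries in $\mathbb H_{\mathbb C}$. $\mathbb S$ (resp. $\mathbb S'$) is the space $\mathbb C^2$ of columns (resp. rows), a left (resp. right) $\mathbb H_{\mathbb C}$-module. The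 $n$-fold tensor power $\mathbb S\otimes\cdots\otimes\mathbb S$ (resp. $\mathbb S'\otimes\cdots\otimes\mathbb S'$) is a left (resp. right) module over the $n$-fold tensor product $\mathbb H_{\mathbb C}\otimes\cdots\otimes\mathbb H_{\mathbb C}$, and $\mathbb S\odot\cdots\odot\mathbb S$, $\mathbb S'\odot\cdots\odot\mathbb S'$ denote the subspaces of symmetric $n$-tensors. For $k=1,\dots,n$ let $\nabla^+_k=\sum_{i=0}^3(1\otimes\cdots\otimes e_i\otimes\cdots\otimes1)\frac{\partial}{\partial z^i}$ with $e_i$ in the $k$-th place. For open $U\subset\mathbb H_{\mathbb C}$, a holomorphic $f:U\to\mathbb S\odot\cdots\odot\mathbb S$ is left $n$-regular if $\nabla_k^+f=0$ on $U$ for all $k=1,\dots,n$; a holomorphic $g:U\to\mathbb S'\odot\cdots\odot\mathbb S'$ is right $n$-regular if $\sum_{i=0}^3\frac{\partial g}{\partial z^i}(1\otimes\cdots\otimes e_i\otimes\cdots\otimes1)=0$ ($e_i$ in the $k$-th place) on $U$ for all $k=1,\dots,n$. ''Possibly with singularities'' means that functions are defined on open subsets of $\mathbb H_{\mathbb C}$; the transformed functions are considered on the open set where the formulas below make sense. For $h=\begin{pmatrix}a'&b'\\c'&d'\end{pmatrix}\in GL(2,\mathbb H_{\mathbb C})$ with $h^{-1}=\begin{pmatrix}a&b\\c&d\end{pmatrix}$, $$(\pi_{nl}(h)f)(Z)=\frac{(cZ+d)^{-1}\otimes\cdots\otimes(cZ+d)^{-1}}{N(cZ+d)}\cdot f\bigl((aZ+b)(cZ+d)^{-1}\bigr),$$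 $$(\pi_{nr}(h)g)(Z)=g\bigl((a'-Zc')^{-1}(-b'+Zd')\bigr)\cdot\frac{(a'-Zc')^{-1}\otimes\cdots\otimes(a'-Zc')^{-1}}{N(a'-Zc')}$$ ($n$ tensor factors). *)

(* Defs.v *)
From HB Require Import structures.
From mathcomp Require Import all_boot all_order all_algebra all_fingroup.
From mathcomp Require Import ring.
From mathcomp Require Import complex.
From mathcomp Require Import all_classical all_reals all_analysis.

Set Implicit Arguments.
Unset Strict Implicit.
Unset Printing Implicit Defensive.

Import Order.TTheory GRing.Theory Num.Theory.
Import numFieldNormedType.Exports.

Local Open Scope classical_set_scope.
Local Open Scope ring_scope.

(* Declared as a numClosedFieldType so that the normed-space structure of a
   numFieldType over itself is inferred. Hence [differentiable] and ['D_v] on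
   spaces over [Cplx R] are meant over the complex scalars. *)
Definition Cplx (R : realType) : numClosedFieldType := R[i].

Definition mx2 (R : realType) (a b c d : Cplx R) : 'M[Cplx R]_2 :=
  \matrix_(p, q) nth 0 (nth [::] [:: [:: a; b]; [:: c; d]] p) q.

(* Complexified quaternions, as complex 2 x 2 matrices. Topology and
   differentiation do not depend on the basis used for coordinates. *)
Notation HC R := 'M[Cplx R]_2.

(* The units e_0, e_1, e_2, e_3, which form a basis of HC R. *)
Definition quat (R : realType) (i : 'I_4) : HC R :=
  nth 0 [:: mx2 1 0 0 1;
            mx2 0 (- 'i) (- 'i) 0;
            mx2 0 (- 1) 1 0;
            mx2 (- 'i) 0 0 'i] i.

Definition qnorm (R : realType) (Z : HC R) : Cplx R := \det Z.

Lemma mx2E (R : realType) (Z : HC R) :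
  Z = mx2 (Z ord0 ord0) (Z ord0 ord_max) (Z ord_max ord0) (Z ord_max ord_max).
Proof.
apply/matrixP => -[[|[|//]] p] [[|[|//]] q]; rewrite !mxE /=;
  by congr (Z _ _); apply/val_inj.
Qed.

Lemma quat_sum (R : realType) (z : 'I_4 -> Cplx R) :
  \sum_i z i *: quat R i =
  mx2 (z (inord 0) - 'i * z (inord 3)) (- z (inord 2) - 'i * z (inord 1))
      (z (inord 2) - 'i * z (inord 1)) (z (inord 0) + 'i * z (inord 3)).
Proof.
have -> : inord 0 = ord0 :> 'I_4 by apply/val_inj; rewrite /= inordK.
have -> : inord 1 = lift ord0 ord0 :> 'I_4 by apply/val_inj; rewrite /= inordK.
have -> : inord 2 = lift ord0 (lift ord0 ord0) :> 'I_4
  by apply/val_inj; rewrite /= inordK.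
have -> : inord 3 = lift ord0 (lift ord0 (lift ord0 ord0)) :> 'I_4
  by apply/val_inj; rewrite /= inordK.
rewrite !big_ord_recl big_ord0.
by apply/matrixP => -[[|[|//]] p] [[|[|//]] q]; rewrite !mxE /=; ring.
Qed.

Lemma quat_span (R : realType) (Z : HC R) :
  exists z : 'I_4 -> Cplx R, Z = \sum_i z i *: quat R i.
Proof.
have i2 : 'i * 'i = -1 :> Cplx R by rewrite -expr2 sqrCi.
have n2 : 2 != 0 :> Cplx R by rewrite pnatr_eq0.
pose a := Z ord0 ord0; pose b := Z ord0 ord_max.
pose c := Z ord_max ord0; pose d := Z ord_max ord_max.
exists (fun i => nth 0 [:: (a + d) / 2; 'i * (b + c) / 2; (c - b) / 2;
                          'i * (a - d) / 2] i).
rewrite quat_sum !inordK //= [LHS]mx2E -/a -/b -/c -/d.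
have i2M x : 'i * ('i * x / 2) = - (x / 2) :> Cplx R.
  by rewrite -mulrA mulrA i2 mulN1r.
rewrite !i2M; congr mx2; rewrite ?opprK -?mulNr -mulrDl; apply: canRL (mulfK n2) _; ring.
Qed.

Lemma qnormE (R : realType) (z : 'I_4 -> Cplx R) :
  qnorm (\sum_i z i *: quat R i) = \sum_i z i ^+ 2.
Proof.
have i2 : 'i * 'i = -1 :> Cplx R by rewrite -expr2 sqrCi.
have -> : \sum_i z i ^+ 2 = z (inord 0) ^+ 2 + z (inord 1) ^+ 2
    + z (inord 2) ^+ 2 + z (inord 3) ^+ 2.
  rewrite !big_ord_recl big_ord0 addr0 !addrA.
  by do ?congr (_ + _); congr (z _ ^+ 2); apply/val_inj; rewrite /= inordK.
rewrite quat_sum /qnorm (expand_det_row _ ord0) !big_ord_recl big_ord0.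
rewrite /cofactor !det_mx11 !mxE /= expr0 expr1 mul1r addr0 mulN1r mulrN.
ring: i2.
Qed.

Lemma quat_relations (R : realType) (e := fun i => quat R (inord i)) :
  [/\ e 0 = 1,
      forall i, (0 < i < 4)%N -> e i * e i = - e 0,
      e 1 * e 2 * e 3 = - e 0
    & forall i j, (0 < i < j)%N -> (j < 4)%N -> e i * e j = - (e j * e i)].
Proof.
have i2 : 'i * 'i = -1 :> Cplx R by rewrite -expr2 sqrCi.
have eE i : (i < 4)%N -> e i = nth 0 [:: mx2 1 0 0 1;
            mx2 0 (- 'i) (- 'i) 0; mx2 0 (- 1) 1 0; mx2 (- 'i) 0 0 'i] i.
  by move=> i4; rewrite /e /quat inordK.
have M a b c d a' b' c' d' : mx2 a b c d * mx2 a' b' c' d' =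
    mx2 (a * a' + b * c') (a * b' + b * d') (c * a' + d * c') (c * b' + d * d')
    :> HC R.
  rewrite /GRing.mul /=; apply/matrixP => -[[|[|//]] p] [[|[|//]] q];
  by rewrite !mxE !big_ord_recl big_ord0 !mxE /= addr0.
have N a b c d : - mx2 a b c d = mx2 (- a) (- b) (- c) (- d) :> HC R.
  by apply/matrixP => -[[|[|//]] p] [[|[|//]] q]; rewrite !mxE.
split.
- rewrite eE //=; apply/matrixP => -[[|[|//]] p] [[|[|//]] q]; by rewrite !mxE.
- move=> [|[|[|[|//]]]] //= _; rewrite !eE //= M N; congr mx2; ring: i2.
- rewrite !eE //= !M N; congr mx2; ring: i2.
- move=> [|[|[|[|?]]]] [|[|[|[|?]]]] //= _ _; rewrite !eE //= !M N; congr mx2; ring: i2.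
Qed.

(* A basis of the n-fold tensor power of C^2 is indexed by n-digit
   multi-indices; a tensor is the column (or row) of its coordinates. *)
Definition midx (n : nat) : finType := {ffun 'I_n -> 'I_2}.

Definition digit (n : nat) (p : 'I_#|midx n|) (k : 'I_n) : 'I_2 :=
  (enum_val p : {ffun 'I_n -> 'I_2}) k.

Notation tensC R n := 'cV[Cplx R]_#|midx n|.
Notation tensR R n := 'rV[Cplx R]_#|midx n|.

Definition pureC (R : realType) (n : nat) (s : 'I_n -> 'cV[Cplx R]_2) :
    tensC R n :=
  \col_p \prod_(k < n) s k (digit p k) 0.

Definition pureR (R : realType) (n : nat) (s : 'I_n -> 'rV[Cplx R]_2) :
    tensR R n :=
  \row_q \prod_(k < n) s k 0 (digit q k).

(* A_0 (x) ... (x) A_(n-1), as a matrix acting on tensC R n on the left and on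
   tensR R n on the right. *)
Definition tensH (R : realType) (n : nat) (A : 'I_n -> HC R) :
    'M[Cplx R]_#|midx n| :=
  \matrix_(p, q) \prod_(k < n) A k (digit p k) (digit q k).

Lemma tensH_pureC (R : realType) (n : nat) (A : 'I_n -> HC R)
    (s : 'I_n -> 'cV[Cplx R]_2) :
  tensH A *m pureC s = pureC (fun k => A k *m s k).
Proof.
apply/colP => p; rewrite !mxE.
under eq_bigr do rewrite !mxE -big_split /=.
under [RHS]eq_bigr do rewrite mxE.
rewrite bigA_distr_bigA /= [RHS](reindex (@enum_val _ (midx n))) //=.
by exists enum_rank => i _; rewrite ?enum_valK ?enum_rankK.
Qed.

Lemma pureR_tensH (R : realType) (n : nat) (A : 'I_n -> HC R)
    (s : 'I_n -> 'rV[Cplx R]_2) :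
  pureR s *m tensH A = pureR (fun k => s k *m A k).
Proof.
apply/rowP => q; rewrite !mxE.
under eq_bigr do rewrite !mxE -big_split /=.
under [RHS]eq_bigr do rewrite mxE.
rewrite bigA_distr_bigA /= [RHS](reindex (@enum_val _ (midx n))) //=.
by exists enum_rank => i _; rewrite ?enum_valK ?enum_rankK.
Qed.

Definition tens_at (R : realType) (n : nat) (k : 'I_n) (X : HC R) :
    'M[Cplx R]_#|midx n| :=
  tensH (fun j => if j == k then X else 1).

Definition tens_pow (R : realType) (n : nat) (X : HC R) :
    'M[Cplx R]_#|midx n| :=
  tensH (fun _ : 'I_n => X).

Definition permute_midx (n : nat) (s : 'S_n) (I : {ffun 'I_n -> 'I_2}) : midx n :=
  [ffun k => I (s k)].

Definition symC (R : realType) (n : nat) : set (tensC R n) :=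
  [set t | forall (s : 'S_n) (I : midx n),
     t (enum_rank (permute_midx s I)) 0 = t (enum_rank I) 0].

Definition symR (R : realType) (n : nat) : set (tensR R n) :=
  [set t | forall (s : 'S_n) (I : midx n),
     t 0 (enum_rank (permute_midx s I)) = t 0 (enum_rank I)].

(* A function possibly with singularities: a domain, and a total function whose
   values outside of the domain are irrelevant. *)
Record sfun (R : realType) (V : Type) := SFun {
  dom : set (HC R);
  fn :> HC R -> V
}.

(* Since the quat R i form a basis, the partial derivative with respect to the
   coordinate z^i is the directional derivative along quat R i. *)
Definition nablaL (R : realType) (n : nat) (k : 'I_n) (f : HC R -> tensC R n)
    (Z : HC R) : tensC R n :=
  \sum_(i < 4) tens_at k (quat R i) *m 'D_(quat R i) f Z.

Definition nablaR (R : realType) (n : nat) (k : 'I_n) (g : HC R -> tensR R n)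
    (Z : HC R) : tensR R n :=
  \sum_(i < 4) 'D_(quat R i) g Z *m tens_at k (quat R i).

Definition holomorphic_on (R : realType) (V : normedModType (Cplx R))
    (U : set (HC R)) (f : HC R -> V) : Prop :=
  forall Z, U Z -> differentiable f Z.

Definition left_regular (R : realType) (n : nat) :
    set (sfun R (tensC R n)) :=
  [set f | [/\ open (dom f),
     forall Z, dom f Z -> symC (f Z),
     holomorphic_on (dom f) f
   & forall (k : 'I_n) Z, dom f Z -> nablaL k f Z = 0]].

Definition right_regular (R : realType) (n : nat) :
    set (sfun R (tensR R n)) :=
  [set g | [/\ open (dom g),
     forall Z, dom g Z -> symR (g Z),
     holomorphic_on (dom g) g
   & forall (k : 'I_n) Z, dom g Z -> nablaR k g Z = 0]].

(* A 2 x 2 matrix over HC R is represented as the complex 4 x 4 matrix having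
   its four entries as 2 x 2 blocks; the product of matrices over HC R is then
   the product of complex matrices. *)
Notation M2HC R := 'M[Cplx R]_(2 + 2).

Definition GL2HC (R : realType) : set (M2HC R) := [set h | h \in unitmx].

Definition pi_l (R : realType) (n : nat) (h : M2HC R)
    (f : sfun R (tensC R n)) : sfun R (tensC R n) :=
  let a : HC R := ulsubmx (invmx h) in
  let b : HC R := ursubmx (invmx h) in
  let c : HC R := dlsubmx (invmx h) in
  let d : HC R := drsubmx (invmx h) in
  SFun
    [set Z | c * Z + d \is a GRing.unit /\
             dom f ((a * Z + b) * (c * Z + d)^-1)]
    (fun Z => (qnorm (c * Z + d))^-1 *:
       (tens_pow n (c * Z + d)^-1 *m f ((a * Z + b) * (c * Z + d)^-1))).

Definition pi_r (R : realType) (n : nat) (h : M2HC R)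
    (g : sfun R (tensR R n)) : sfun R (tensR R n) :=
  let a' : HC R := ulsubmx h in
  let b' : HC R := ursubmx h in
  let c' : HC R := dlsubmx h in
  let d' : HC R := drsubmx h in
  SFun
    [set Z | a' - Z * c' \is a GRing.unit /\
             dom g ((a' - Z * c')^-1 * (- b' + Z * d'))]
    (fun Z => (qnorm (a' - Z * c'))^-1 *:
       (g ((a' - Z * c')^-1 * (- b' + Z * d')) *m
        tens_pow n (a' - Z * c')^-1)).

(* Main.v *)
From HB Require Import structures.
Require Import Defs.
From mathcomp Require Import all_boot all_order all_algebra all_fingroup.
From mathcomp Require Import ring.
From mathcomp Require Import complex.
From mathcomp Require Import all_classical all_reals all_analysis.

(* Since sum_i e_i (x) e_i is, up to the factor 2, the tensor
   epsilon (x) epsilon, regularity in the k-th slot says that the contraction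
   of the k-th slot of df(u v) with w is symmetric in v and w, for every column
   u and all rows v, w. Write W = cZ + d, Y = (aZ + b) W^-1, x = W^-1 c u, and
   let F be the transform of f. As dY(u v) = (a - Yc)u . vW^-1 has rank one
   again,
     dF(u v) = N(W)^-1 W^-1 (x) ... (x) W^-1 df_Y((a - Yc)u . vW^-1)
               - (v x) F - sum_j (x v)_j F,
   where (x v)_j acts in the j-th slot. Contract the k-th slot with w. The first
   term is symmetric in v and w by the regularity of f; the second one is
   exchanged with the summand j = k of the third one; each summand j <> k is
   symmetric because F takes symmetric values. The right-handed case follows by
   transposing Z and the values of g. *)

Set Implicit Arguments.
Unset Strict Implicit.
Unset Printing Implicit Defensive.

Import Order.TTheory GRing.Theory Num.Theory.
Import numFieldNormedType.Exports.
(* [simple_functions] defines another [sfun]. *)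
Import Defs.

Local Open Scope classical_set_scope.
Local Open Scope ring_scope.

(** * Differential calculus of matrix-valued maps, up to the inverse of a 2 x 2 matrix *)

Section Calculus.
Variables (K : numFieldType) (V : normedModType K).
Implicit Types x : V.

Lemma is_diff_coord m n (f df : V -> 'M[K]_(m, n)) x i j :
  is_diff x f df -> is_diff x (fun z => f z i j : K) (fun h => df h i j : K).
Proof.
move=> fx.
have @c : {linear 'M[K]_(m, n) -> K}.
  by exists (fun N : 'M[K]_(_, _) => N i j); do 2![eexists]; do ?[constructor];
     rewrite ?mxE// => ? *; rewrite ?mxE//; move=> ?; rewrite !mxE.
have cc : is_diff (f x) c c.
  have cont : continuous c by exact: coord_continuous.
  by apply: DiffDef; [exact: linear_differentiable | exact: diff_lin].
exact: (is_diff_comp fx cc).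
Qed.

Lemma is_diff_sum (W : normedModType K) I (r : seq I) (f df : I -> V -> W) x :
  (forall i, is_diff x (f i) (df i)) ->
  is_diff x (fun z => \sum_(i <- r) f i z) (fun h => \sum_(i <- r) df i h).
Proof.
move=> fx; elim: r => [|i r IH].
  under eq_fun do rewrite big_nil.
  apply: (is_diff_eq (is_diff_cst _ _)).
  by apply/funext => h; rewrite big_nil.
under eq_fun do rewrite big_cons.
apply: (is_diff_eq (is_diffD (fx i) IH)).
by apply/funext => h; rewrite big_cons.
Qed.

Lemma is_diffZr (W : normedModType K) (w : W) (f df : V -> K) x :
  is_diff x f df -> is_diff x (fun z => f z *: w) (fun h => df h *: w).
Proof. by move=> fx; exact: (is_diff_comp fx (is_diff_scalel _ _)). Qed.

Lemma is_diff_mx m n (f df : V -> 'M[K]_(m, n)) x :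
  (forall i j, is_diff x (fun z => f z i j : K) (fun h => df h i j : K)) ->
  is_diff x f df.
Proof.
move=> fx.
have -> : f = fun z => \sum_i \sum_j f z i j *: delta_mx i j.
  by apply/funext => z; rewrite [LHS]matrix_sum_delta.
have -> : df = fun z => \sum_i \sum_j df z i j *: delta_mx i j.
  by apply/funext => z; rewrite [LHS]matrix_sum_delta.
by apply: is_diff_sum => i; apply: is_diff_sum => j; apply: is_diffZr.
Qed.

Lemma is_diff_mulK (f g df dg : V -> K) x :
  is_diff x f df -> is_diff x g dg ->
  is_diff x (fun z => f z * g z) (fun h => df h * g x + f x * dg h).
Proof.
move=> fx gx; apply: (is_diff_eq (is_diffM fx gx)).
by apply/funext => h; rewrite addrC; congr (_ + _); apply: mulrC.
Qed.

Lemma is_diff_mulmx m n p (f df : V -> 'M[K]_(m, n)) (g dg : V -> 'M[K]_(n, p))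
    x :
  is_diff x f df -> is_diff x g dg ->
  is_diff x (fun z => f z *m g z) (fun h => df h *m g x + f x *m dg h).
Proof.
move=> fx gx; apply: is_diff_mx => i j; under eq_fun do rewrite mxE.
apply: (is_diff_eq (is_diff_sum _ (fun k =>
  is_diff_mulK (is_diff_coord i k fx) (is_diff_coord k j gx)))).
by apply/funext => h; rewrite !mxE -big_split.
Qed.

Lemma is_diff_scalemx m n (f df : V -> K) (g dg : V -> 'M[K]_(m, n)) x :
  is_diff x f df -> is_diff x g dg ->
  is_diff x (fun z => f z *: g z) (fun h => df h *: g x + f x *: dg h).
Proof.
move=> fx gx; apply: is_diff_mx => i j; under eq_fun do rewrite mxE.
apply: (is_diff_eq (is_diff_mulK fx (is_diff_coord i j gx))).
by apply/funext => h; rewrite !mxE.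
Qed.

Lemma is_diff_prod (I : eqType) (r : seq I) (f df : I -> V -> K) x : uniq r ->
  (forall i, is_diff x (f i) (df i)) ->
  is_diff x (fun z => \prod_(i <- r) f i z)
    (fun h => \sum_(j <- r) \prod_(i <- r) (if i == j then df i h else f i x)).
Proof.
move=> + fx; elim: r => [_|i r IH /= /andP[ir /IH{}IH]].
  under eq_fun do rewrite big_nil.
  apply: (is_diff_eq (is_diff_cst _ _)).
  by apply/funext => h; rewrite big_nil.
under eq_fun do rewrite big_cons.
apply: (is_diff_eq (is_diff_mulK (fx i) IH)).
apply/funext => h; rewrite big_cons big_cons eqxx; congr (_ * _ + _).
  by apply: eq_big_seq => j jr; case: eqP => // jE; rewrite -jE jr in ir.
rewrite big_distrr; apply: eq_big_seq => j jr /=; rewrite big_cons.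
by case: eqP => // iE; rewrite iE jr in ir.
Qed.

Lemma is_diff_invK (f df : V -> K) x : f x != 0 -> is_diff x f df ->
  is_diff x (fun z => (f z)^-1) (fun h => - (f x)^-2 * df h).
Proof.
move=> fx0 fx.
have iv : is_diff (f x) (GRing.inv : K -> K) ( *:%R (- (f x)^-2)).
  apply: DiffDef; first exact: differentiable_Rinv.
  by rewrite diff_Rinv.
exact: (is_diff_comp fx iv).
Qed.

Lemma det2E (A : 'M[K]_2) : \det A =
  A ord0 ord0 * A ord_max ord_max - A ord0 ord_max * A ord_max ord0.
Proof.
rewrite (expand_det_row _ ord0) !big_ord_recl big_ord0 /cofactor !det_mx11 !mxE.
rewrite /= expr0 expr1 mul1r addr0 mulN1r mulrN.
by congr (_ * A _ _ - A _ _ * A _ _); apply/val_inj.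
Qed.

(** A differential depends only on the germ, since the remainder estimate transfers from [f] to [g].
    This serves the adjugate formula for the inverse, which is valid at invertible matrices. *)
Lemma is_diff_near (W : normedModType K) (f g df : V -> W) x :
  (\forall z \near x, f z = g z) -> is_diff x f df -> is_diff x g df.
Proof.
move=> fg fx.
have fgx : f x = g x by move: fg => /nbhs_singleton.
have dfx : differentiable f x by exact: ex_diff.
have [dfc /eqaddoP gE] := (diff_locallyP _ _).1 dfx.
have {}gE : g \o shift x = cst (g x) + 'd f x +o_ (0 : V) id.
  apply/eqaddoP => e e0.
  move: fg; rewrite (near_shift 0 x) => fg.
  apply: filterS2 (gE e e0) fg => h /=; rewrite !fctE /= subr0.
  by rewrite -fgx => + <-.
have dg : 'd g x = 'd f x :> (V -> W) by exact: diff_unique.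
apply: DiffDef; last by rewrite dg diff_val.
by apply/diff_locallyP; rewrite dg.
Qed.

(** In dimension two the adjugate is linear in the matrix, hence its own differential. *)
Lemma adj2E (A : 'M[K]_2) : \adj A = (\tr A)%:M - A.
Proof.
have l0 : lift ord_max ord0 = ord0 :> 'I_2 by apply/val_inj.
have l1 : lift ord0 ord0 = ord_max :> 'I_2 by apply/val_inj.
apply/matrixP => i j; rewrite /mxtrace !big_ord_recl big_ord0 !mxE addr0 l1.
rewrite /cofactor det_mx11 !mxE.
case: (unliftP ord0 i) => [i'|] ->; rewrite ?[i']ord1 ?l1;
case: (unliftP ord0 j) => [j'|] ->; rewrite ?[j']ord1 ?l1 ?l0 /=; ring.
Qed.

Lemma is_diff_det2 (X dX : V -> 'M[K]_2) x : is_diff x X dX ->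
  is_diff x (fun z => \det (X z)) (fun h => \tr (\adj (X x) *m dX h)).
Proof.
move=> Xx; under eq_fun do rewrite det2E.
apply: (is_diff_eq (is_diffB
  (is_diff_mulK (is_diff_coord _ _ Xx) (is_diff_coord _ _ Xx))
  (is_diff_mulK (is_diff_coord _ _ Xx) (is_diff_coord _ _ Xx)))).
apply/funext => h; rewrite adj2E mulmxBl mul_scalar_mx linearB linearZ /=.
have l1 : lift ord0 ord0 = ord_max :> 'I_2 by apply/val_inj.
rewrite /mxtrace !big_ord_recl !big_ord0 !mxE !big_ord_recl !big_ord0 !l1.
rewrite !fctE; ring.
Qed.

(** Polarising [X *m \adj X = (\det X)%:M] gives [X *m \adj H + H *m \adj X = (\tr (\adj X *m
    H))%:M]; multiply on the left by [\adj X]. This turns the quotient rule into the usual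
    derivative of the inverse. *)
Lemma adj2_sandwich (X H : 'M[K]_2) : \adj X *m H *m \adj X =
  \tr (\adj X *m H) *: \adj X - \det X *: \adj H.
Proof.
rewrite det2E !adj2E.
have l1 : lift ord0 ord0 = ord_max :> 'I_2 by apply/val_inj.
apply/matrixP => i j; rewrite /mxtrace.
do !rewrite ?big_ord_recl ?big_ord0 ?mxE ?l1.
case: (unliftP ord0 i) => [i'|] ->; rewrite ?[i']ord1 ?l1;
case: (unliftP ord0 j) => [j'|] ->; rewrite ?[j']ord1 ?l1 /=; ring.
Qed.

Lemma nbhs_unitmx2 (X dX : V -> 'M[K]_2) x :
  is_diff x X dX -> X x \is a GRing.unit ->
  \forall z \near x, X z \is a GRing.unit.
Proof.
move=> Xx Xu; have detx := is_diff_det2 Xx.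
have det0 : \det (X x) != 0 by rewrite -unitfE -unitmxE.
have cdet : {for x, continuous (fun z => \det (X z))}.
  by apply: differentiable_continuous; exact: ex_diff.
apply: filterS (cvgr_neq0 _ cdet det0) => z.
by rewrite -unitfE -unitmxE.
Qed.

Lemma invmx2E (X : 'M[K]_2) : X \is a GRing.unit ->
  X^-1 = (\det X)^-1 *: \adj X.
Proof. by move=> Xu; rewrite /GRing.inv /= /invmx Xu. Qed.

Lemma is_diff_inv2 (X dX : V -> 'M[K]_2) x : X x \is a GRing.unit ->
  is_diff x X dX ->
  is_diff x (fun z => (X z)^-1) (fun h => - ((X x)^-1 * dX h * (X x)^-1)).
Proof.
move=> Xu Xx; have detx := is_diff_det2 Xx.
have det0 : \det (X x) != 0 by rewrite -unitfE -unitmxE.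
have adjx : is_diff x (fun z => \adj (X z)) (fun h => \adj (dX h)).
  under eq_fun do rewrite adj2E -scalemx1.
  have trx : is_diff x (fun z => \tr (X z)) (fun h => \tr (dX h)).
    by apply: is_diff_sum => i; exact: is_diff_coord.
  apply: (is_diff_eq (is_diffB (is_diffZr 1%:M trx) Xx)).
  by apply/funext => h; rewrite adj2E -[in RHS]scalemx1.
apply: (@is_diff_near _ (fun z => (\det (X z))^-1 *: \adj (X z))).
  by apply: filterS (nbhs_unitmx2 Xx Xu) => z /invmx2E.
apply: (is_diff_eq (is_diff_scalemx (is_diff_invK det0 detx) adjx)).
apply/funext => h; rewrite invmx2E //.
set D := \det (X x); set t := \tr _.
have -> : D^-1 *: \adj (X x) * dX h * (D^-1 *: \adj (X x)) =
    D^-2 *: (\adj (X x) *m dX h *m \adj (X x)).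
  by rewrite -!scalerAl -scalerAr scalerA -invfM -expr2.
rewrite adj2_sandwich -/t -/D scalerBr !scalerA opprB addrC; congr (_ + _).
  by rewrite expr2 invfM mulfVK.
by rewrite mulNr scaleNr.
Qed.

End Calculus.

(** * Tensor products of matrices acting slot by slot, and symmetric tensors *)

Section Tensors.
Variables (R : realType) (n : nat).
Local Notation K := (Cplx R).
Implicit Types (A B : 'I_n -> HC R) (k : 'I_n) (X Y : HC R) (t : tensC R n).

Lemma tensH_mul A B : tensH A *m tensH B = tensH (fun k => A k *m B k).
Proof.
apply/matrixP => p r; rewrite !mxE.
under eq_bigr do rewrite !mxE -big_split /=.
under [RHS]eq_bigr do rewrite mxE.
rewrite bigA_distr_bigA /= [RHS](reindex (@enum_val _ (midx n))) //=.
by exists enum_rank => i _; rewrite ?enum_valK ?enum_rankK.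
Qed.

Lemma tens_at_mul k X Y : tens_at k X *m tens_at k Y = tens_at k (X *m Y).
Proof.
rewrite /tens_at tensH_mul; congr tensH; apply/funext => j.
by case: eqP => // _; rewrite mul1mx.
Qed.

Lemma tensHE A p q : tensH A p q = \prod_k A k (digit p k) (digit q k).
Proof. by rewrite mxE. Qed.

Lemma tens_atE k X p q : tens_at k X p q =
  X (digit p k) (digit q k) *
  \prod_(i < n | i != k) (1 : HC R) (digit p i) (digit q i).
Proof.
rewrite tensHE (bigD1 k) //= eqxx; congr (_ * _).
by apply: eq_bigr => i /negPf ->.
Qed.

Lemma tens_at_is_linear k : linear (@tens_at R n k).
Proof.
move=> a X Y; apply/matrixP => p q; rewrite [RHS]mxE.
rewrite [X in _ = X + _]mxE !tens_atE.
by rewrite [(_ + Y) _ _]mxE [(a *: X) _ _]mxE mulrDl mulrA.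
Qed.

HB.instance Definition _ k := GRing.isLinear.Build K (HC R)
  'M[K]_#|midx n| *:%R (@tens_at R n k) (@tens_at_is_linear k).

Lemma tens_at_pow k X Y : X \is a GRing.unit ->
  tens_at k Y *m tens_pow n X = tens_pow n X *m tens_at k (X^-1 *m Y *m X).
Proof.
move=> Xu; rewrite /tens_at /tens_pow !tensH_mul; congr tensH.
apply/funext => j; case: eqP => _; last by rewrite mul1mx mulmx1.
by rewrite !mulmxE !mulrA divrr // mul1r.
Qed.

Lemma tens_pow_at_sum k X Y :
  tensH (fun j => if j == k then Y *m X else X) = tens_at k Y *m tens_pow n X.
Proof.
rewrite /tens_at /tens_pow tensH_mul; congr tensH.
by apply/funext => j; case: eqP => // _; rewrite mul1mx.
Qed.

Definition midx_perm (s : 'S_n) (p : 'I_#|midx n|) : 'I_#|midx n| :=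
  enum_rank (permute_midx s (enum_val p)).

Lemma midx_permK s : cancel (midx_perm s) (midx_perm s^-1%g).
Proof.
move=> p; rewrite /midx_perm enum_rankK -[RHS]enum_valK; congr enum_rank.
by apply/ffunP => i; rewrite !ffunE permKV.
Qed.

Lemma digit_midx_perm s p k : digit (midx_perm s p) k = digit p (s k).
Proof. by rewrite /digit enum_rankK ffunE. Qed.

Lemma symC_midx_perm t s p : symC t -> t (midx_perm s p) 0 = t p 0.
Proof. by move=> tS; rewrite tS enum_valK. Qed.

Lemma reindex_midx_perm (s : 'S_n) (F : 'I_#|midx n| -> K) :
  \sum_p F p = \sum_p F (midx_perm s p).
Proof.
apply: reindex; exists (midx_perm s^-1%g) => p _; first exact: midx_permK.
by rewrite -{1}[s]invgK midx_permK.
Qed.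

(** The same matrix sits in every slot, so permuting row and column digits together only reorders
    the product that gives an entry. *)
Lemma symC_tens_pow X t : symC t -> symC (tens_pow n X *m t).
Proof.
move=> tS s I; rewrite !mxE (reindex_midx_perm s).
apply: eq_bigr => q _; rewrite symC_midx_perm // !mxE; congr (_ * _).
rewrite [RHS](reindex_inj (@perm_inj _ s)) /=; apply: eq_bigr => k _.
by rewrite digit_midx_perm /digit !enum_rankK ffunE.
Qed.

Lemma symCZ (a : K) t : symC t -> symC (a *: t).
Proof. by move=> tS s I; rewrite !mxE tS. Qed.

(** Reindex the sum over the coordinates of [t] by the transposition of [j] and [k]: [t] is
    unchanged, while the digits at which [v] and [w] are evaluated trade places. *)
Lemma tens_at_swap j k (x s : 'cV[K]_2) (v w : 'rV[K]_2) t : j != k -> symC t ->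
  tens_at k (s *m w) *m (tens_at j (x *m v) *m t) =
  tens_at k (s *m v) *m (tens_at j (x *m w) *m t).
Proof.
move=> jk tS; rewrite !mulmxA.
have kj : k != j by rewrite eq_sym.
have outer (c : 'cV[K]_2) (r : 'rV[K]_2) i l : (c *m r) i l = c i 0 * r 0 l.
  by rewrite mxE big_ord1.
have coef (v' w' : 'rV[K]_2) p q :
    (tens_at k (s *m w') *m tens_at j (x *m v')) p q =
    (x (digit p j) 0 * v' 0 (digit q j)) *
    ((s (digit p k) 0 * w' 0 (digit q k)) *
    \prod_(i < n | (i != j) && (i != k)) (1 : HC R) (digit p i) (digit q i)).
  rewrite tensH_mul tensHE (bigD1 j) // (bigD1 k) //= !eqxx.
  rewrite (negPf jk) (negPf kj) mul1mx mulmx1 !outer; congr (_ * (_ * _)).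
  by apply: eq_bigr => i /andP[/negPf -> /negPf ->]; rewrite mul1mx.
apply/colP => p; rewrite [LHS]mxE [RHS]mxE [LHS](reindex_midx_perm (tperm j k)).
apply: eq_bigr => q _; rewrite symC_midx_perm //; congr (_ * _).
rewrite !coef !digit_midx_perm tpermL tpermR [LHS]mulrACA [RHS]mulrACA.
rewrite !mulrA; congr (_ * _); last first.
  by apply: eq_bigr => l /andP[lj lk]; rewrite digit_midx_perm tpermD 1?eq_sym.
ring.
Qed.

(* The column s turns the contraction of the k-th slot with w into the action of
   the rank-one matrix s w there, so that no contraction has to be defined. *)
Definition slot_sym k (L : HC R -> tensC R n) :=
  forall (s u : 'cV[K]_2) (v w : 'rV[K]_2),
  tens_at k (s *m w) *m L (u *m v) = tens_at k (s *m v) *m L (u *m w).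

End Tensors.

(** * Regularity in one slot as a symmetry on rank-one matrices *)

Section Nabla.
Variables (R : realType) (n : nat).
Local Notation K := (Cplx R).
Implicit Types (k : 'I_n) (X Y : HC R) (t : tensC R n).
Local Notation E a b := (delta_mx a b : HC R).
Local Notation o0 := (ord0 : 'I_2).
Local Notation o1 := (ord_max : 'I_2).

Lemma ord2_ind (P : 'I_2 -> Prop) : P o0 -> P o1 -> forall i, P i.
Proof.
move=> P0 P1 i; case: (unliftP ord0 i) => [j|] -> //.
by rewrite [j]ord1 (_ : lift _ _ = o1) //; apply/val_inj.
Qed.

(** The units pair off, [e_0] with [e_3] and [e_1] with [e_2]: in each pair the terms
    [f (E a b) (E a b)] cancel and the mixed terms double. What remains is twice the polarised
    determinant. *)
Lemma sum_quat (f : HC R -> HC R -> tensC R n) :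
  (forall X, linear (f X)) -> (forall Y, linear (f^~ Y)) ->
  \sum_(i < 4) f (quat R i) (quat R i) =
  2 *: (f (E o0 o0) (E o1 o1) - f (E o0 o1) (E o1 o0) +
        (f (E o1 o1) (E o0 o0) - f (E o1 o0) (E o0 o1))).
Proof.
move=> fr fl.
have mx2D (a b c d : K) : mx2 a b c d =
    a *: E o0 o0 + (b *: E o0 o1 + (c *: E o1 o0 + (d *: E o1 o1 + 0))).
  apply/matrixP => i j; rewrite !mxE.
  by elim/ord2_ind: i; elim/ord2_ind: j; rewrite /= ?mulr1 ?mulr0 ?addr0 ?add0r.
have fr0 X : f X 0 = 0.
  by have := fr X (-1) 0 0; rewrite scaler0 addr0 scaleN1r addNr.
have fl0 X : f 0 X = 0.
  by have := fl X (-1) 0 0; rewrite scaler0 addr0 scaleN1r addNr.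
have frE X (a b c d : K) : f X (mx2 a b c d) = a *: f X (E o0 o0) +
    (b *: f X (E o0 o1) + (c *: f X (E o1 o0) + d *: f X (E o1 o1))).
  by rewrite mx2D !fr fr0 addr0.
have flE X (a b c d : K) : f (mx2 a b c d) X = a *: f (E o0 o0) X +
    (b *: f (E o0 o1) X + (c *: f (E o1 o0) X + d *: f (E o1 o1) X)).
  by rewrite mx2D !fl fl0 addr0.
rewrite !big_ord_recl big_ord0 /quat /= !flE !frE.
do 16!move: (f (delta_mx _ _) (delta_mx _ _)) => ?.
apply/colP => p; rewrite !mxE.
have i2 : 'i * 'i = -1 :> K by rewrite -expr2 sqrCi.
ring: i2.
Qed.

(** Multiplying on the left by [F a i] kills the bracket whose matrix units start at [j] and moves
    the row of the other one from [i] to [a], so one equation splits into two. *)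
Lemma matrix_unit_separation (S : pzRingType) m (I : eqType)
    (F : I -> I -> 'M[S]_m) (N : I -> I -> 'cV[S]_m) (i j a : I) :
  (forall a b c, F a b *m F b c = F a c) ->
  (forall a b b' c, b != b' -> F a b *m F b' c = 0) -> i != j ->
  F i i *m N j j - F i j *m N j i + (F j j *m N i i - F j i *m N i j) = 0 ->
  F a i *m N j j = F a j *m N j i.
Proof.
move=> FM F0 ij /(congr1 (mulmx (F a i))).
rewrite mulmx0 mulmxDr !mulmxBr !mulmxA !FM !F0 // !mul0mx subr0 addr0.
by move/eqP; rewrite subr_eq0 => /eqP.
Qed.

(** As [T] is multiplicative, the images of matrix units multiply like matrix units. The vanishing
    sum is separated on them, and the result extends bilinearly to all rank-one matrices. *)
Lemma sum_quat_eq0P (T : {linear HC R -> 'M[K]_#|midx n|})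
    (L : {linear HC R -> tensC R n}) :
  (forall X Y, T X *m T Y = T (X *m Y)) ->
  \sum_(i < 4) T (quat R i) *m L (quat R i) = 0 <->
  forall (s u : 'cV[K]_2) (v w : 'rV[K]_2),
    T (s *m w) *m L (u *m v) = T (s *m v) *m L (u *m w).
Proof.
move=> TM; rewrite (@sum_quat (fun X Y => T X *m L Y)); first last.
- by move=> Y a X X'; rewrite linearP mulmxDl scalemxAl.
- by move=> X a Y Y'; rewrite linearP mulmxDr scalemxAr.
have n2 : 2 != 0 :> K by rewrite pnatr_eq0.
split=> [/eqP|LS]; last first.
  have {}LS (p q : 'I_2) :
      T (E p o0) *m L (E q o1) = T (E p o1) *m L (E q o0).
    by have := LS (delta_mx p 0) (delta_mx q 0) (delta_mx 0 o1) (delta_mx 0 o0);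
       rewrite !mul_delta_mx.
  by rewrite !LS !subrr addr0 scaler0.
rewrite scaler_eq0 (negPf n2) /= => /eqP nab.
pose F a b := T (E a b); pose N p q := L (E p q).
have FM a b c : F a b *m F b c = F a c by rewrite /F TM mul_delta_mx.
have F0 a b b' c : b != b' -> F a b *m F b' c = 0.
  by move=> bb; rewrite /F TM mul_delta_mx_0 // linear0.
(* For [p = o1] the separation is used with [i = o0] and [j = o1]; for [p = o0] the roles are
   reversed, so the two brackets have to be exchanged. *)
have key a p : F a o0 *m N p o1 = F a o1 *m N p o0.
  elim/ord2_ind: p; last first.
    exact: (@matrix_unit_separation _ _ _ F N o0 o1 a FM F0 isT nab).
  apply/esym/(@matrix_unit_separation _ _ _ F N o1 o0 a FM F0 isT).
  by rewrite addrC.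
have {}key a p j q : F a j *m N p q = F a q *m N p j.
  by elim/ord2_ind: j; elim/ord2_ind: q.
have expand (c d : 'cV[K]_2) (x y : 'rV[K]_2) : T (c *m x) *m L (d *m y) =
  \sum_i \sum_p \sum_j \sum_q
    (c i 0 * x 0 j * (d p 0 * y 0 q)) *: (F i j *m N p q).
  rewrite [c *m x]matrix_sum_delta [d *m y]matrix_sum_delta linear_sum.
  rewrite mulmx_suml; apply: eq_bigr => i _.
  rewrite linear_sum [X in _ *m X]linear_sum mulmx_sumr; apply: eq_bigr => p _.
  rewrite mulmx_suml; apply: eq_bigr => j _.
  rewrite linear_sum mulmx_sumr; apply: eq_bigr => q _.
  rewrite !linearZ /= -scalemxAl scalerA [X in X *: _ = _]mulrC.
  by rewrite [(c *m x) i j]mxE [(d *m y) p q]mxE !big_ord1.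
move=> s u v w; rewrite !expand; apply: eq_bigr => i _; apply: eq_bigr => p _.
rewrite exchange_big; apply: eq_bigr => j _; apply: eq_bigr => q _.
rewrite key; congr (_ *: _); ring.
Qed.

Lemma slot_symP k (L : {linear HC R -> tensC R n}) :
  \sum_(i < 4) tens_at k (quat R i) *m L (quat R i) = 0 <-> slot_sym k L.
Proof. exact: (sum_quat_eq0P (T := @tens_at R n k) L (tens_at_mul k)). Qed.

End Nabla.

(** * Fractional linear substitutions and their effect on left regularity *)

Lemma is_diff_tens_pow (R : realType) n (V : normedModType (Cplx R))
    (X dX : V -> HC R) (x : V) : is_diff x X dX ->
  is_diff x (fun z => tens_pow n (X z))
    (fun h => \sum_(j < n) tensH (fun k => if k == j then dX h else X x)).
Proof.
move=> Xx; apply: is_diff_mx => p q; under eq_fun do rewrite tensHE.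
apply: (is_diff_eq (is_diff_prod (index_enum_uniq _) (fun k =>
  is_diff_coord (digit p k) (digit q k) Xx))).
apply/funext => h; rewrite summxE; apply: eq_bigr => j _.
by rewrite tensHE; apply: eq_bigr => k _; case: eqP.
Qed.

Section Moebius.
Variables (R : realType) (n : nat) (a b c d : HC R).
Local Notation K := (Cplx R).
Implicit Types (Z H : HC R).

Let W Z := c * Z + d.
Let Y Z := (a * Z + b) * (W Z)^-1.

(** With the four blocks as parameters, one transform serves both actions: [pi_l] directly and
    [pi_r] after transposition. *)
Definition moebius (f : sfun R (tensC R n)) : sfun R (tensC R n) :=
  SFun
    [set Z | c * Z + d \is a GRing.unit /\
             dom f ((a * Z + b) * (c * Z + d)^-1)]
    (fun Z => (qnorm (c * Z + d))^-1 *: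
       (tens_pow n (c * Z + d)^-1 *m f ((a * Z + b) * (c * Z + d)^-1))).

Lemma is_diff_affine (p q Z : HC R) :
  is_diff Z (fun Z => p * Z + q : HC R) (fun H => p * H : HC R).
Proof.
apply: (is_diff_eq (is_diffD (is_diff_mulmx (is_diff_cst p Z) (is_diff_id Z))
  (is_diff_cst q Z))).
by apply/funext => H; rewrite !fctE /= mul0mx add0r addr0.
Qed.

Lemma is_diff_denom_inv Z : W Z \is a GRing.unit ->
  is_diff Z (fun Z => (W Z)^-1) (fun H => - ((W Z)^-1 * (c * H) * (W Z)^-1)).
Proof. by move=> Wu; exact: (is_diff_inv2 Wu (is_diff_affine c d Z)). Qed.

(** The derivative regroups with [H] between two fixed factors, so a product of a column and a row
    is sent to another one. *)
Lemma is_diff_moebius_arg Z : W Z \is a GRing.unit ->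
  is_diff Z Y (fun H => (a - Y Z * c) * H * (W Z)^-1).
Proof.
move=> Wu.
apply: (is_diff_eq
  (is_diff_mulmx (is_diff_affine a b Z) (is_diff_denom_inv Wu))).
apply/funext => H.
by rewrite !mulmxE mulrN !mulrA -mulrBl -mulrBl.
Qed.

(** Product rule for three factors: the scalar gives the trace, the tensor power the sum over slots,
    and [f] the chain-rule term. *)
Lemma is_diff_moebius (f : sfun R (tensC R n)) Z :
  W Z \is a GRing.unit -> differentiable f (Y Z) ->
  is_diff Z (moebius f) (fun H =>
    (qnorm (W Z))^-1 *: (tens_pow n (W Z)^-1 *m
      'd f (Y Z) ((a - Y Z * c) * H * (W Z)^-1))
    - (\tr ((W Z)^-1 * c * H) *: moebius f Z
       + \sum_j tens_at j ((W Z)^-1 * c * H) *m moebius f Z)).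
Proof.
move=> Wu fY.
have det0 : \det (W Z) != 0 by rewrite -unitfE -unitmxE.
have dN := is_diff_invK (f := fun Z => \det (W Z)) det0
  (is_diff_det2 (is_diff_affine c d Z)).
have dP := is_diff_tens_pow n (is_diff_denom_inv Wu).
have df := is_diff_comp (is_diff_moebius_arg Wu) (differentiableP fY).
apply: (is_diff_eq (is_diff_scalemx dN (is_diff_mulmx dP df))).
apply/funext => H.
rewrite /= -/(W Z) -/(Y Z) /qnorm.
set D := \det (W Z); set P := tens_pow n _; set t := f (Y Z).
set L := 'd f (Y Z) _.
have trE : - D ^- 2 * \tr (\adj (W Z) *m (c * H)) =
    - (\tr ((W Z)^-1 * c * H) * D^-1).
  rewrite invmx2E // -mulrA -scalerAl mxtraceZ mulmxE expr2 invfM; ring.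
have powE : \sum_(j < n) tensH (fun k : 'I_n =>
    if k == j then - ((W Z)^-1 * (c * H) / W Z) else (W Z)^-1) =
    - (\sum_j tens_at j ((W Z)^-1 * c * H)) *m P.
  rewrite -sumrN mulmx_suml; apply: eq_bigr => j _.
  rewrite -[X in _ = X *m _]linearN /= /P -tens_pow_at_sum.
  congr tensH; apply/funext => k.
  by case: eqP => // _; rewrite mulNmx mulmxE !mulrA.
rewrite trE powE -mulmx_suml -[in RHS]scalemxAr [in RHS]mulmxA !mulNmx.
by rewrite scaleNr -scalerA scalerDr scalerN opprD addrA addrC.
Qed.

(** Moving the slot action across the tensor power replaces [s] by [B^-1 *m s]; the argument of [L]
    has [A *m u] for [u]. Both rows are multiplied by the same [B], so the symmetry of [L] carries
    over. *)
Lemma slot_sym_pow k (L : HC R -> tensC R n) (N : K) (A B : HC R) :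
  B \is a GRing.unit -> slot_sym k L ->
  slot_sym k (fun H => N *: (tens_pow n B *m L (A * H * B))).
Proof.
move=> Bu LS s u v w.
have swap (r : 'rV[K]_2) : tens_at k (s *m r) *m tens_pow n B =
    tens_pow n B *m tens_at k ((B^-1 *m s) *m (r *m B)).
  by rewrite tens_at_pow // !mulmxA.
have arg (r : 'rV[K]_2) : A * (u *m r) * B = (A *m u) *m (r *m B).
  by rewrite -!mulmxE !mulmxA.
have push (r r' : 'rV[K]_2) :
    tens_at k (s *m r) *m (N *: (tens_pow n B *m L (A * (u *m r') * B))) =
    N *: (tens_pow n B *m (tens_at k ((B^-1 *m s) *m (r *m B)) *m
                           L ((A *m u) *m (r' *m B)))).
  by rewrite -scalemxAr (mulmxA (tens_at k (s *m r))) swap -mulmxA arg.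
by rewrite [LHS]push LS -[LHS]push.
Qed.

(** Swapping [v] and [w] exchanges the trace term with the summand of slot [k]; the weight [N(W)^-1]
    is what gives the trace the matching coefficient. The other slots fall to [tens_at_swap]. *)
Lemma slot_sym_action k (Q : HC R) (t : tensC R n) : symC t ->
  slot_sym k (fun H => \tr (Q * H) *: t + \sum_j tens_at j (Q * H) *m t).
Proof.
move=> tS s u v w.
have outer (r : 'rV[K]_2) : Q * (u *m r) = (Q *m u) *m r.
  by rewrite -mulmxE mulmxA.
have trE (r : 'rV[K]_2) : \tr ((Q *m u) *m r) = (r *m (Q *m u)) 0 0.
  by rewrite mxtrace_mulC /mxtrace big_ord1.
have same (r r' : 'rV[K]_2) :
    tens_at k (s *m r) *m (tens_at k ((Q *m u) *m r') *m t) =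
    (r *m (Q *m u)) 0 0 *: (tens_at k (s *m r') *m t).
  rewrite mulmxA tens_at_mul mulmxA -[s *m r *m _]mulmxA.
  rewrite {1}[r *m (Q *m u)]mx11_scalar mul_mx_scalar -scalemxAl linearZ /=.
  by rewrite -scalemxAl.
have expand (r r' : 'rV[K]_2) :
    tens_at k (s *m r) *m (\tr (Q * (u *m r')) *: t +
                           \sum_j tens_at j (Q * (u *m r')) *m t) =
    (r' *m (Q *m u)) 0 0 *: (tens_at k (s *m r) *m t) +
    ((r *m (Q *m u)) 0 0 *: (tens_at k (s *m r') *m t) +
     \sum_(j | j != k) tens_at k (s *m r) *m (tens_at j ((Q *m u) *m r') *m t)).
  rewrite outer trE (bigD1 k) // mulmxDr -scalemxAr mulmxDr same.
  by rewrite mulmx_sumr.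
rewrite [LHS]expand [RHS]expand [LHS]addrCA; congr (_ + (_ + _)).
by apply: eq_bigr => j jk; exact: tens_at_swap.
Qed.

Lemma slot_symB k (L M : HC R -> tensC R n) :
  slot_sym k L -> slot_sym k M -> slot_sym k (fun H => L H - M H).
Proof. by move=> LS MS s u v w; rewrite !mulmxBr LS MS. Qed.

Lemma nablaL_slot_sym k (f : HC R -> tensC R n) Z : differentiable f Z ->
  nablaL k f Z = 0 <-> slot_sym k ('d f Z).
Proof.
move=> df; rewrite -slot_symP /nablaL.
by under eq_bigr do rewrite deriveE //.
Qed.

Lemma left_regular_moebius (f : sfun R (tensC R n)) :
  left_regular f -> left_regular (moebius f).
Proof.
move=> [fo fS fd freg].
have dF Z : dom (moebius f) Z -> _ := fun '(conj Wu fY) =>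
  is_diff_moebius Wu (fd _ fY).
split.
(* Near [Z] the denominator stays invertible, and continuity of the substitution keeps its value
   inside the open set [dom f]. *)
- rewrite openE => Z [Wu fY].
  have cY := differentiable_continuous
    (ex_diff (is_diff_def := is_diff_moebius_arg Wu)).
  have fN : \forall z \near Z, dom f ((a * z + b) * (c * z + d)^-1).
    by apply: cY; apply: open_nbhs_nbhs.
  exact: filterS2 (nbhs_unitmx2 (is_diff_affine c d Z) Wu) fN.
- by move=> Z [_ fY]; apply: symCZ; apply: symC_tens_pow; exact: fS.
- by move=> Z /dF FZ; exact: ex_diff.
- move=> k Z DZ; have FZ := dF Z DZ; case: (DZ) => Wu fY.
  apply/nablaL_slot_sym; first exact: ex_diff.
  rewrite diff_val; apply: slot_symB.
    apply: slot_sym_pow; rewrite ?unitrV //.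
    by apply/nablaL_slot_sym; [exact: fd | exact: freg].
  apply: slot_sym_action.
  by apply: symCZ; apply: symC_tens_pow; exact: fS.
Qed.

End Moebius.

(** * Transposition, exchanging right and left regularity *)

Lemma is_diff_tr (K : numFieldType) (V : normedModType K) m n
    (f df : V -> 'M[K]_(m, n)) (x : V) :
  is_diff x f df -> is_diff x (fun z => (f z)^T) (fun h => (df h)^T).
Proof.
move=> fx; apply: is_diff_mx => i j; under eq_fun do rewrite mxE.
apply: (is_diff_eq (is_diff_coord j i fx)).
by apply/funext => h; rewrite mxE.
Qed.

Lemma is_diff_conj_tr (K : numFieldType) m n p q
    (f df : 'M[K]_(m, n) -> 'M[K]_(p, q)) (x : 'M[K]_(n, m)) :
  is_diff (x^T) f df ->
  is_diff x (fun z => (f z^T)^T) (fun h => (df h^T)^T).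
Proof.
move=> fx; apply: is_diff_tr.
exact: (is_diff_comp (is_diff_tr (is_diff_id x)) fx).
Qed.

Lemma open_tr (K : numFieldType) m n (A : set 'M[K]_(m, n)) :
  open A -> open [set z : 'M[K]_(n, m) | A z^T].
Proof.
move: A; apply/continuousP => z; apply: differentiable_continuous.
exact: (ex_diff (is_diff_def := is_diff_tr (is_diff_id z))).
Qed.

Section Transposition.
Variables (R : realType) (n : nat).
Local Notation K := (Cplx R).
Implicit Types (Z H : HC R) (k : 'I_n) (g : sfun R (tensR R n)).

Definition sfun_tr g : sfun R (tensC R n) :=
  SFun [set Z | dom g Z^T] (fun Z => (g Z^T)^T).

Lemma tensH_tr (A : 'I_n -> HC R) : (tensH A)^T = tensH (fun k => (A k)^T).
Proof.
apply/matrixP => p q; rewrite mxE !tensHE.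
by apply: eq_bigr => k _; rewrite mxE.
Qed.

Lemma tens_at_tr k (X : HC R) : (tens_at k X)^T = tens_at k X^T.
Proof.
rewrite tensH_tr; congr tensH; apply/funext => j.
by case: eqP => // _; rewrite trmx1.
Qed.

Lemma symR_tr (t : tensR R n) : symR t <-> symC t^T.
Proof. by split=> tS s I; move: (tS s I); rewrite !mxE. Qed.

(** Only the unit [e_2] is antisymmetric, with scalar -1; the other three are symmetric. *)
Lemma quat_tr i : exists e : K, (quat R i)^T = e *: quat R i.
Proof.
have mx2_tr (p q r s : K) : (mx2 p q r s)^T = mx2 p r q s.
  by apply/matrixP => -[[|[|//]] u] [[|[|//]] v]; rewrite !mxE.
have mx2Z (e p q r s : K) :
    e *: mx2 p q r s = mx2 (e * p) (e * q) (e * r) (e * s).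
  by apply/matrixP => -[[|[|//]] u] [[|[|//]] v]; rewrite !mxE.
exists (if val i == 2%N then -1 else 1).
case: i => [[|[|[|[|//]]]] lt4]; rewrite /quat /= mx2_tr mx2Z;
  by rewrite ?mul1r ?mulr0 ?mulN1r ?opprK.
Qed.

Lemma nablaL_tr k g Z : differentiable g Z ->
  nablaL k (sfun_tr g) Z^T = (nablaR k g Z)^T.
Proof.
move=> gd; rewrite linear_sum; apply: eq_bigr => i _ /=.
have gd' : is_diff (Z^T^T) g ('d g Z) by rewrite trmxK; exact: differentiableP.
have trd := is_diff_conj_tr gd'.
rewrite deriveE; last exact: ex_diff.
rewrite (diff_val (is_diff_def := trd)) deriveE // trmx_mul tens_at_tr.
(* The scalar comes out once on each side: from the direction of differentiation on the left, from
   the slot action on the right. *)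
have [e ->] := quat_tr i.
by rewrite !linearZ /= -scalemxAl.
Qed.

Lemma right_regularP g : right_regular g <-> left_regular (sfun_tr g).
Proof.
split=> -[go gS gd greg].
- have gd' Z : dom (sfun_tr g) Z -> is_diff (Z^T) g ('d g (Z^T)).
    by move=> gZ; apply/differentiableP/gd.
  split=> [|Z gZ|Z gZ|k Z gZ].
  + exact: open_tr.
  + by apply/symR_tr/gS.
  + exact: (ex_diff (is_diff_def := is_diff_conj_tr (gd' Z gZ))).
  + by have := nablaL_tr k (gd _ gZ); rewrite trmxK greg // trmx0.
- have gd' Z : dom g Z -> differentiable g Z.
    move=> gZ; have gZ' : dom (sfun_tr g) Z^T by rewrite /= trmxK.
    have gttE : (fun z => (sfun_tr g z^T)^T) = g.
      by apply/funext => z; rewrite /= !trmxK.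
    rewrite -gttE.
    have D := is_diff_conj_tr (differentiableP (gd _ gZ')).
    exact: (ex_diff (is_diff_def := D)).
  split=> [|Z gZ|//|k Z gZ].
  + have := open_tr go; congr open; apply/seteqP.
    by split=> Z /=; rewrite trmxK.
  + by apply/symR_tr; have := gS Z^T; rewrite /= trmxK; apply.
  + apply: trmx_inj; rewrite -nablaL_tr; last exact: gd'.
    by rewrite trmx0; apply: greg; rewrite /= trmxK.
Qed.

(** Transposition reverses products, so the inverse denominator moves from the left of the argument
    to its right. The blocks are those of [h] itself, as in [pi_r]. *)
Lemma sfun_tr_pi_r (h : M2HC R) g :
  sfun_tr (pi_r h g) =
  moebius (drsubmx h)^T (- (ursubmx h)^T) (- (dlsubmx h)^T) (ulsubmx h)^T
    (sfun_tr g).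
Proof.
set a := ulsubmx h; set b := ursubmx h; set c := dlsubmx h; set d := drsubmx h.
have WE Z : - c^T * Z + a^T = (a - Z^T * c)^T.
  by rewrite [RHS]linearB /= -mulmxE trmx_mul trmxK mulmxE mulNr addrC.
have YE Z : d^T * Z + - b^T = (- b + Z^T * d)^T.
  by rewrite [RHS]linearD linearN /= -mulmxE trmx_mul trmxK addrC.
have VE (X : HC R) : (X^T)^-1 = (X^-1)^T by exact: esym (trmx_inv X).
have argE Z : (d^T * Z + - b^T) * (- c^T * Z + a^T)^-1 =
    ((a - Z^T * c)^-1 * (- b + Z^T * d))^T.
  by rewrite WE YE VE -!mulmxE trmx_mul.
congr SFun.
  apply/funext => Z /=; rewrite argE WE trmxK; congr (is_true _ /\ _).
  exact: esym (unitmx_tr _).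
apply/funext => Z /=; rewrite argE WE trmxK /qnorm det_tr VE linearZ /=.
by rewrite trmx_mul tensH_tr.
Qed.

End Transposition.

Theorem theorem5 (R : realType) (n : nat) (hn : (1 <= n)%N) :
  (forall h, GL2HC h ->
     @pi_l R n h @` @left_regular R n `<=` @left_regular R n) /\
  (forall h, GL2HC h ->
     @pi_r R n h @` @right_regular R n `<=` @right_regular R n).
Proof.
(* [pi_l h] is, by conversion, [moebius] for the blocks of [invmx h]. *)
split=> h _ _ [f fR <-]; first exact: left_regular_moebius.
apply/right_regularP; rewrite sfun_tr_pi_r; apply: left_regular_moebius.
exact/right_regularP.
Qed.
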